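(* The Lie algebra $\mathbf L(G_{\mathrm{TM}})=T_eG_{\mathrm{TM}}$ of the Butcher group is $(\mathbb R^{\mathcal T},[\cdot,\cdot])$, where the Lie bracket of $\mathbf a,\mathbf b\in\mathbb R^{\mathcal T}$ is given for $\tau\in\mathcal T$ by $$[\mathbf a,\mathbf b](\tau)=\sum_{s\in \mathrm{SP}(\tau)_1}\bigl(\mathbf b(s_\tau)\,\mathbf a(\tau\setminus s)-\mathbf b(\tau\setminus s)\,\mathbf a(s_\tau)\bigr).$$
   Context: Trees: A rooted tree is a non-empty connected finite graph without cycles with a distinguished node (the root); rooted trees are identified if they are isomorphic via a root-preserving graph isomorphism. $\mathcal T$ is the (countable) set of all rooted trees, $\emptyset$ is the empty tree, $\mathcal T_0=\mathcal T\cup\{\emptyset\}$. An ordered subtree of $\tau\in\mathcal T_0$ is a subset $s$ of the vertices of $\tau$ that is connected by edges of $\tau$ and, if non-empty, contains the root of $\tau$; $\mathrm{OST}(\tau)$ is the set of all ordered subtrees. For $s\in\mathrm{OST}(\tau)$, $s_\tau$ is the rooted tree with vertex set $s$ and root and edges induced by $\tau$ ($s_\tau=\emptyset$ if $s=\emptyset$), and $\tau\setminus s$ is the forest (finite collection, with multiplicity, of rooted trees) obtained from $\tau$ by removing $s$ and its adjacent edges. The set of non-trivial splittings $\mathrm{SP}(\tau)_1$ consists of those $s\in\mathrm{OST}(\tau)$ with $s\neq\emptyset$, $s\ne\tau$ (not all vertices) such that the forest $\tau\setminus s$ consists of exactly one tree (then also denoted $\tau\setminus s$). Butcher group: $G_{\mathrm{TM}}=\{a:\mathcal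 T_0\to\mathbb R\mid a(\emptyset)=1\}$ with multiplication $$(a\cdot b)(\tau)=\sum_{s\in \mathrm{OST}(\tau)} b(s_\tau)\,a(\tau\setminus s),\qquad a(\tau\setminus s)=\prod_{\theta\in\tau\setminus s}a(\theta)$$ (empty product $=1$). The identity is $e$ with $e(\emptyset)=1$, $e(\tau)=0$ for $\tau\in\mathcal T$. $\mathbb R^{\mathcal T}$ is identified with $\{a\in\mathbb R^{\mathcal T_0}\mid a(\emptyset)=0\}$, and carries the topology of pointwise convergence (a Fréchet space). $G_{\mathrm{TM}}=e+\mathbb R^{\mathcal T}$ is a real analytic Lie group (in the sense of Bastiani calculus on locally convex spaces) modelled on $\mathbb R^{\mathcal T}$ with the global chart $a\mapsto a-e$; all tangent spaces are identified with $\mathbb R^{\mathcal T}$. The Lie bracket on $T_eG_{\mathrm{TM}}$ is the one induced by the Lie bracket of left invariant vector fields; equivalently, $[\mathbf a,\mathbf b]=B(\mathbf a,\mathbf b)-B(\mathbf b,\mathbf a)$ with $B(\mathbf a,\mathbf b)=\frac{\partial^2}{\partial r\,\partial t}\big|_{t,r=0}\bigl((e+t\mathbf a)\cdot(e+r\mathbf b)-e\bigr)$. *)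

(* Defs.v *)
From HB Require Import structures.
From mathcomp Require Import all_boot all_order all_algebra generic_quotient zify.
From mathcomp Require Import all_classical all_reals all_analysis.
Import Order.TTheory GRing.Theory Num.Theory numFieldNormedType.Exports.

Set Implicit Arguments.
Unset Strict Implicit.
Unset Printing Implicit Defensive.

Local Open Scope ring_scope.

(* [ucycle] counts the two-element sequence [:: x; y] with [x -- y] as a cycle
   of a symmetric relation, so the cycles of the graph have size at least 3. *)
Definition is_tree (V : finType) (e : rel V) : Prop :=
  [/\ symmetric e, irreflexive e, (forall x y, connect e x y)
    & forall c : seq V, ucycle e c -> (size c <= 2)%N].

Record rtree := RTree {
  tsize : nat;
  tedge : rel 'I_tsize;
  troot : 'I_tsize;
  rtree_is_tree : is_tree tedge }.

HB.instance Definition _ := gen_eqMixin rtree.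
HB.instance Definition _ := gen_choiceMixin rtree.

Definition tree_iso (t u : rtree) : Prop :=
  exists f : 'I_(tsize t) -> 'I_(tsize u),
    [/\ bijective f, f (troot t) = troot u
      & forall x y, tedge (f x) (f y) = tedge x y].

Lemma tree_iso_refl t : tree_iso t t.
Proof. by exists id; split=> //; exists id. Qed.

Lemma tree_iso_sym t u : tree_iso t u -> tree_iso u t.
Proof.
move=> [f [[g fK gK] fr fe]]; exists g; split; first by exists f.
- by rewrite -fr fK.
- by move=> x y; rewrite -fe !gK.
Qed.

Lemma tree_iso_trans t u w : tree_iso t u -> tree_iso u w -> tree_iso t w.
Proof.
move=> [f [bf fr fe]] [g [bg gr ge]]; exists (g \o f); split => /=.
- exact: bij_comp.
- by rewrite fr.
- by move=> x y; rewrite ge fe.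
Qed.

Definition tree_isob : rel rtree := fun t u => `[< tree_iso t u >].

Lemma tree_isob_equiv : equiv_class_of tree_isob.
Proof.
split.
- by move=> t; apply/asboolP/tree_iso_refl.
- by move=> t u; apply/asboolP/asboolP => /tree_iso_sym.
- move=> u t w /asboolP tu /asboolP uw; apply/asboolP.
  exact: tree_iso_trans tu uw.
Qed.

Canonical tree_iso_equiv := EquivRelPack tree_isob_equiv.

(* The set of rooted trees; the set with the empty tree adjoined is
   [option tree], with [None] the empty tree. *)
Definition tree := {eq_quot tree_iso_equiv}%qT.

HB.instance Definition _ := Choice.on tree.
HB.instance Definition _ := Quotient.on tree.

Definition tree_of (t : rtree) : tree := (\pi_tree t)%qT.

Section Subtrees.
Variable t : rtree.
Local Notation V := 'I_(tsize t).
Implicit Types (s : {set V}) (v r : V).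

Definition edge_in s : rel V := [rel x y | [&& x \in s, y \in s & tedge x y]].

Definition connected_in s : bool :=
  [forall x in s, forall y in s, connect (edge_in s) x y].

Lemma connected_inP s :
  reflect {in s &, forall x y, connect (edge_in s) x y} (connected_in s).
Proof.
apply: (iffP forall_inP) => [h x y xs ys|h x xs].
  by have /forall_inP := h x xs; apply.
by apply/forall_inP => y ys; exact: h.
Qed.

Lemma induced_is_tree s : connected_in s ->
  is_tree (relpre (@enum_val _ (mem s)) (@tedge t)).
Proof.
move=> /connected_inP cs; have [tsym tirr _ tac] := rtree_is_tree t; split.
- by move=> x y; exact: tsym.
- by move=> x; exact: tirr.
- move=> x y.
  have /connectP[p] := cs _ _ (enum_valP x) (enum_valP y).
  elim: p x => [|z p IHp] x /=; first by move=> _ /enum_val_inj ->.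
  case/andP=> /and3P[_ zs xz] pz yl.
  have zE : z = enum_val (enum_rank_in zs z) by rewrite enum_rankK_in.
  rewrite zE in pz yl xz.
  by apply: connect_trans (IHp _ pz yl); exact: connect1.
- move=> c /andP[cc uc]; rewrite -(size_map (@enum_val _ (mem s))).
  apply: tac; apply/andP; split; first by rewrite cycle_map.
  by rewrite map_inj_uniq //; exact: enum_val_inj.
Qed.

Definition induced s r (h : (r \in s) && connected_in s) : rtree :=
  @RTree #|s| _ (enum_rank_in (andP h).1 r) (induced_is_tree (andP h).2).

Definition OST : {set {set V}} :=
  [set s : {set V} | (s != finset.set0) ==> (troot t \in s) && connected_in s].

(* For [s] in [OST] the value is [None] only for empty [s] ([subtree_None]). *)
Definition subtree s : option tree :=
  if @idP ((troot t \in s) && connected_in s) is ReflectT h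
  then Some (tree_of (induced h)) else None.

Lemma subtree_None s : s \in OST -> (subtree s == None) = (s == finset.set0).
Proof.
rewrite inE /subtree; case: eqVneq => [s0 _|_ /= h]; case: {-}_ / idP => // h'.
by exfalso; move: h'; rewrite s0 inE.
Qed.

(* The connected component of [v] in the complement of [s], for [v] outside
   [s]. *)
Definition component s v : {set V} :=
  [set w | connect (edge_in (finset.setC s)) v w].

Lemma mem_component s v : v \in component s v.
Proof. by rewrite inE connect0. Qed.

Lemma component_connected s v :
  (v \in component s v) && connected_in (component s v).
Proof.
rewrite mem_component /=; apply/connected_inP.
have [tsym _ _ _] := rtree_is_tree t.
have sym A : connect_sym (edge_in A).
  by apply: sym_connect_sym => x y; rewrite /edge_in /= tsym andbCA.
suff H w : w \in component s v -> connect (edge_in (component s v)) v w.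
  move=> x y xs ys; apply: connect_trans (H _ ys); rewrite sym; exact: H.
rewrite inE => /connectP[p]; elim/last_ind: p w => [|p z IHp] w /=.
  by move=> _ ->; exact: connect0.
rewrite rcons_path last_rcons => /andP[pp lz] ->.
have cl : last v p \in component s v by rewrite inE; apply/connectP; exists p.
apply: connect_trans (IHp _ pp erefl) _; apply: connect1.
rewrite /edge_in /= cl /=; apply/andP; split; last by case/and3P: lz.
by move: cl; rewrite !inE => cl; apply: connect_trans cl _; exact: connect1.
Qed.

(* The roots of the trees of the forest obtained by removing [s] from [t]: the
   vertices outside [s] attached to [s], or the root of [t] if [s] is empty.
   Each component has exactly one such vertex ([forest_rootP]). *)
Definition forest_roots s : {set V} :=
  [set v | (v \notin s) && ((v == troot t) || [exists u in s, tedge u v])].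

Definition forest s : seq tree :=
  [seq tree_of (induced (component_connected s v)) | v <- enum (forest_roots s)].

Lemma forest_rootP s v : s \in OST -> v \notin s ->
  exists! r, r \in forest_roots s /\ v \in component s r.
Proof.
have [tsym tirr tconn tac] := rtree_is_tree t.
have sym A : connect_sym (edge_in A).
  by apply: sym_connect_sym => x y; rewrite /edge_in /= tsym andbCA.
move=> sO vs.
suff [[r rP] H] : (exists r, r \in forest_roots s /\ v \in component s r) /\
    (forall r r', r \in forest_roots s -> r' \in forest_roots s ->
      connect (edge_in (finset.setC s)) r r' -> r = r').
  exists r; split=> // r' [r'f vr']; case: rP => rf vr; apply: H => //.
  by rewrite !inE in vr vr'; apply: connect_trans vr _; rewrite sym.
have [s0|s0] := eqVneq s finset.set0.
  split.
    exists (troot t); split; first by rewrite s0 !inE eqxx.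
    rewrite inE s0; apply: (connect_sub _ (tconn _ _)) => x y xy.
    by apply: connect1; rewrite /edge_in /= !inE.
  have root_only r : r \in forest_roots s -> r = troot t.
    rewrite inE s0 => /andP[_ /orP[/eqP//|/existsP[x]]].
    by rewrite inE.
  by move=> r r' /root_only-> /root_only->.
move: sO; rewrite inE s0 /= => /andP[rs /connected_inP cs]; split.
  have /connectP[p] := tconn (troot t) v; elim/last_ind: p v vs => [|p z IHp] v vs.
    by move=> _ vE; rewrite vE rs in vs.
  rewrite rcons_path last_rcons => /andP[pp lz] vE; subst z.
  have [ls|ls] := boolP (last (troot t) p \in s).
    exists v; split; last exact: mem_component.
    by rewrite inE vs; apply/orP; right; apply/existsP; exists (last (troot t) p); rewrite ls.
  have [r [rf lr]] := IHp _ ls pp erefl; exists r; split=> //.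
  move: lr; rewrite !inE => lr; apply: connect_trans lr _; apply: connect1.
  by rewrite /edge_in /= !inE ls vs.
move=> r r'; rewrite 2!finset.in_set => /andP[nr +] /andP[nr' +].
have nrt x : x \notin s -> (x == troot t) = false.
  by move=> xs; apply/eqP => xE; rewrite xE rs in xs.
rewrite !nrt //= => /existsP[u /andP[us ur]] /existsP[u' /andP[us' ur']].
have [//|rr'] := eqVneq r r'.
case/connectP=> p0 /shortenP[p pp up _] lp {p0}.
have /connectP[q0 /shortenP[q pq uq _] lq {q0}] := cs _ _ us' us.
have sub A : subrel (edge_in A) (@tedge t) by move=> x y /and3P[].
have inA (A : {set 'I_(tsize t)}) x c : x \in A -> path (edge_in A) x c -> {subset x :: c <= A}.
  elim: c x => [|y c IHc] x xA /=; first by move=> _ z; rewrite inE => /eqP->.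
  case/andP=> /and3P[_ yA _] yc z; rewrite inE => /orP[/eqP->//|].
  exact: IHc yA yc z.
have rC : r \in finset.setC s by rewrite inE.
suff /tac : ucycle (@tedge t) ((r :: p) ++ u' :: q).
  rewrite size_cat /=; case: p lp {pp up} => [rE|y p _ /=]; last by lia.
  by rewrite rE eqxx in rr'.
apply/andP; split.
  rewrite /cycle /= rcons_cat cat_path rcons_path /= (sub_path (@sub _) pp).
  by rewrite -lp tsym ur' (sub_path (@sub _) pq) -lq ur.
rewrite cat_uniq up uq andbT.
suff /hasPn-> // : {in u' :: q, forall x, x \notin r :: p} by [].
move=> x xq; apply/negP => xp; by have := inA _ _ _ rC pp x xp; rewrite inE (inA _ _ _ us' pq x xq).
Qed.

End Subtrees.

Local Open Scope classical_set_scope.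
Local Open Scope convex_scope.

Definition ptfun (R : realType) (T : choiceType) := {ptws T -> R^o}.

Section PtfunTvs.
Variables (R : realType) (T : choiceType).
Local Notation E := (ptfun R T).

HB.instance Definition _ := Uniform.copy E {ptws T -> R^o}.
HB.instance Definition _ := GRing.Lmodule.copy E (T -> R^o).

Lemma ptfun_cvg (F : set_system E) (f : E) : Filter F ->
  (forall i, (fun g : E => g i) @ F --> f i) -> F --> f.
Proof.
move=> FF Ff; apply/cvg_sup => i A.
rewrite (@nbhsE (initial_topology _)) => -[U [+ Uf] UA].
case=> W oW WU; rewrite -WU in Uf UA.
by apply: filterS UA _; apply: (Ff i); exact: open_nbhs_nbhs.
Qed.

Lemma ptfun_eval_continuous i : continuous (fun g : E => g i : R^o).
Proof. exact: (@proj_continuous T (fun=> R^o) i). Qed.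

Lemma ptfun_add_continuous : continuous (fun x : E * E => x.1 + x.2).
Proof.
move=> [f g].
have FF : Filter ((fun x : E * E => x.1 + x.2) @ (f, g)).
  exact: (@fmap_filter _ _ _ (nbhs (f, g)) _).
apply: (@ptfun_cvg _ (f + g) FF) => i.
have h1 : (fun x : E * E => x.1 i : R^o) @ (f, g) --> (f i : R^o).
  have /= := @continuous_comp (E * E)%type E R^o fst (fun h : E => h i) (f, g).
  by apply; [exact: cvg_fst|exact: ptfun_eval_continuous].
have h2 : (fun x : E * E => x.2 i : R^o) @ (f, g) --> (g i : R^o).
  have /= := @continuous_comp (E * E)%type E R^o snd (fun h : E => h i) (f, g).
  by apply; [exact: cvg_snd|exact: ptfun_eval_continuous].
exact: (@cvgD R R^o _ _ _ _ _ _ _ h1 h2).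
Qed.

Lemma ptfun_scale_continuous : continuous (fun z : R^o * E => z.1 *: z.2).
Proof.
move=> [k f].
have FF : Filter ((fun z : R^o * E => z.1 *: z.2) @ (k, f)).
  exact: (@fmap_filter _ _ _ (nbhs (k, f)) _).
apply: (@ptfun_cvg _ (k *: f) FF) => i.
have h : (fun x : R^o * E => x.2 i : R^o) @ (k, f) --> (f i : R^o).
  have /= := @continuous_comp (R^o * E)%type E R^o snd (fun h : E => h i) (k, f).
  by apply; [exact: cvg_snd|exact: ptfun_eval_continuous].
have h1 : (fun x : R^o * E => x.1) @ (k, f) --> (k : R^o) by exact: cvg_fst.
exact: (@cvgZ R R^o _ _ _ _ _ _ _ h1 h).
Qed.

HB.instance Definition _ :=
  PreTopologicalNmodule_isTopologicalNmodule.Build E ptfun_add_continuous.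
HB.instance Definition _ :=
  TopologicalNmodule_isTopologicalLmodule.Build R E ptfun_scale_continuous.

Lemma ptfun_locally_convex :
  exists2 B : set_system E, (forall b, b \in B -> convex_set b) & basis B.
Proof.
exists [set U : set E | open U /\ convex_set U].
  by move=> b; rewrite inE => -[].
split=> [U []//|f]; apply: ptfun_cvg.
  apply: filter_from_filter; first by exists setT; split=> //; split;
    [exact: openT|move=> x y l _ _; rewrite inE].
  move=> U V [[oU cU] Uf] [[oV cV] Vf]; exists (U `&` V) => //; split=> //.
  split; first exact: openI.
  move=> x y l; rewrite !inE => -[Ux Vx] [Uy Vy].
  by split; apply: set_mem; [apply: cU|apply: cV]; exact: mem_set.
move=> i A fA; have [B Bc [Bo /(_ (f i) A fA)[U [BU Uf] UA]]] :=
  @locally_convex R R^o.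
exists [set g : E | U (g i)]; last by move=> g /= /UA.
split=> //=; split.
  apply: (@open_comp E R^o (fun g => g i)); last exact: Bo.
  by move=> g _; exact: ptfun_eval_continuous.
move=> x y l; rewrite !inE /= => Ux Uy; apply: set_mem.
by apply: (Bc U (mem_set BU) (x i) (y i) l); exact: mem_set.
Qed.

HB.instance Definition _ := Uniform_isTvs.Build R E ptfun_locally_convex.

End PtfunTvs.

Section Calculus.
Variables (R : realType) (E F : tvsType R).

Definition is_dir_derive (f : E -> F) (x v : E) (l : F) : Prop :=
  (fun h : R => h^-1 *: (f (x + h *: v) - f x)) @ 0^' --> l.

Definition dir_derivable (f : E -> F) (x v : E) : Prop :=
  exists l, is_dir_derive f x v l.

Definition dir_derive (f : E -> F) (x v : E) : F :=
  xget 0 (is_dir_derive f x v).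

End Calculus.

Section LieBracket.
Variables (R : realType) (E : tvsType R).

(* Vector fields on a manifold with a global chart are identified with maps on
   the model space. *)
Definition vf_bracket (X Y : E -> E) (x : E) : E :=
  dir_derive Y x (X x) - dir_derive X x (Y x).

Variables (G : Type) (mul : G -> G -> G) (one : G).
Variables (chart : G -> E) (chart_inv : E -> G).

Definition left_translation (g : G) (x : E) : E :=
  chart (mul g (chart_inv x)).

(* The field [g |-> T_e(lambda_g)(a)], read in the chart. *)
Definition left_invariant_field (a : E) (x : E) : E :=
  dir_derive (left_translation (chart_inv x)) (chart one) a.

Definition lie_bracket (a b : E) : E :=
  vf_bracket (left_invariant_field a) (left_invariant_field b) (chart one).

End LieBracket.

Section ButcherGroup.
Variable R : realType.

Record butcher := Butcher {
  butcher_fun :> option tree -> R;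
  butcher_None : butcher_fun None = 1 }.

Definition forest_eval (a : option tree -> R) (F : seq tree) : R :=
  \prod_(theta <- F) a (Some theta).

(* The ordered subtrees of an isomorphism class are those of its chosen
   representative; the only ordered subtree of the empty tree is the empty one. *)
Definition butcher_mul_fun (a b : option tree -> R) (tau : option tree) : R :=
  if tau is Some theta then
    let t := (repr theta)%qT in
    \sum_(s in OST t) b (subtree s) * forest_eval a (forest s)
  else b None * forest_eval a [::].

Lemma butcher_mul_None (a b : butcher) : butcher_mul_fun a b None = 1.
Proof. by rewrite /= butcher_None /forest_eval big_nil mulr1. Qed.

Definition butcher_mul (a b : butcher) : butcher :=
  Butcher (butcher_mul_None a b).

Definition butcher_one : butcher :=
  @Butcher (fun tau => (tau == None)%:R) erefl.

Local Notation RT := (ptfun R tree).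

(* The identification of a function on the non-empty trees with a function
   vanishing at the empty tree. *)
Definition ext0 (x : RT) (tau : option tree) : R := oapp x 0 tau.

Definition butcher_chart (a : butcher) : RT :=
  fun tau => a (Some tau) - butcher_one (Some tau).

Lemma butcher_chart_inv_None (x : RT) : butcher_one None + ext0 x None = 1.
Proof. exact: addr0. Qed.

Definition butcher_chart_inv (x : RT) : butcher :=
  @Butcher (fun tau => butcher_one tau + ext0 x tau) (butcher_chart_inv_None x).

Definition butcher_left_translation : butcher -> RT -> RT :=
  left_translation butcher_mul butcher_chart butcher_chart_inv.

Definition butcher_left_invariant_field : RT -> RT -> RT :=
  left_invariant_field butcher_mul butcher_one butcher_chart butcher_chart_inv.

Definition butcher_lie_bracket : RT -> RT -> RT :=
  lie_bracket butcher_mul butcher_one butcher_chart butcher_chart_inv.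

End ButcherGroup.

Section Splittings.
Variable t : rtree.

Definition SP1 : {set {set 'I_(tsize t)}} :=
  [set s in OST t | [&& s != finset.set0, s != [set: 'I_(tsize t)]%SET
                      & size (forest s) == 1%N]].

(* The forest left by a splitting in [SP1], seen as a tree. *)
Definition remainder (s : {set 'I_(tsize t)}) : option tree := ohead (forest s).

End Splittings.

(* Main.v *)
(* Along a line [h |-> x + h v] every coordinate of a left translation, and of a
   left invariant field, is a polynomial in [h], so directional derivatives are
   the coefficients of degree 1.  In the chart the field of [a] is
   X_a(x)(tau) = sum_s a(s_tau) prod_(theta in tau \ s) x(theta).  At x = 0 only
   the full subtree contributes to its value, so X_a(0) = a, and its derivative
   there only sees the subtrees that leave exactly one tree; the empty subtree
   among them has a(s_tau) = 0, which leaves the splittings in SP(tau)_1. *)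
Require Import Defs.
From mathcomp Require Import all_boot all_order all_algebra generic_quotient.
From mathcomp Require Import all_classical all_reals all_analysis.
Import Order.TTheory GRing.Theory Num.Theory numFieldNormedType.Exports.
Local Open Scope ring_scope.

(** * Directional derivatives of maps polynomial along lines *)

Lemma ptfun_cvg_unique (R : realType) (T : choiceType)
    (F : set_system (ptfun R T)) (f g : ptfun R T) :
  ProperFilter F -> (F --> f)%classic -> (F --> g)%classic -> f = g.
Proof.
move=> FF Ff Fg; apply: funext => i.
have ev (k : ptfun R T) : (F --> k)%classic ->
    ((fun u : ptfun R T => u i : R^o) @ F --> (k i : R^o))%classic.
  by move=> Fk; exact: (cvg_comp _ _ Fk (@ptfun_eval_continuous R T i k)).
exact: (cvg_unique (@norm_hausdorff R R^o) (ev _ Ff) (ev _ Fg)).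
Qed.

(** Limits are unique, so the value picked by [xget] is any limit that has been exhibited. *)
Lemma dir_derive_unique (R : realType) (T : choiceType)
    (f : ptfun R T -> ptfun R T) (x v l : ptfun R T) :
  is_dir_derive f x v l -> dir_derive f x v = l.
Proof.
move=> fl; apply: xget_subset1 => // l1 l2.
exact: ptfun_cvg_unique.
Qed.

Lemma horner_difference_quotient (R : realType) (p : {poly R}) :
  ((fun h : R => h^-1 * (p.[h] - p.[0])) @ 0^' --> p`_1)%classic.
Proof.
pose q := drop_poly 1 p.
have -> : p`_1 = q.[0] by rewrite horner_coef0 coef_drop_poly.
apply: cvg_trans (cvg_trans (cvg_app _ (@nbhs_dnbhs _ (0 : R)))
  (@continuous_horner R q 0)).
apply: near_eq_cvg; near=> h.
have h0 : h != 0 by near: h; exact: nbhs_dnbhs_neq.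
have pE k : p.[k] = p`_0 + q.[k] * k.
  rewrite -[in LHS](poly_take_drop 1 p) hornerD hornerM hornerXn expr1; congr (_ + _).
  by rewrite /take_poly poly_def big_ord1 expr0 alg_polyC hornerC.
by rewrite !pE mulr0 addr0 addrC addKr mulrC mulfK.
Unshelve. all: by end_near. Qed.

(** The product is a monomial of degree [size r]. This singles out the forests made of exactly one
    tree. *)
Lemma coef1_prod_monomials (K : comNzRingType) (I : Type) (r : seq I) (c : I -> K) :
  (\prod_(i <- r) ((c i)%:P * 'X))`_1 = if r is [:: i] then c i else 0.
Proof.
case: r => [|i [|j r]]; first by rewrite big_nil coef1.
  by rewrite big_seq1 coefMX coefC.
by rewrite !big_cons -!mulrA !(coefCM, coefXM) /= !mulr0.
Qed.

(** Pointwise convergence reduces the claim to one real polynomial per coordinate. *)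
Lemma is_dir_derive_horner (R : realType) (T : choiceType)
    (f : ptfun R T -> ptfun R T) (x v : ptfun R T) (p : T -> {poly R}) :
  (forall h i, f (x + h *: v) i = (p i).[h]) ->
  is_dir_derive f x v (fun i => (p i)`_1).
Proof.
move=> fE; refine (ptfun_cvg _ _) => i.
have f0 : f x i = (p i).[0] by rewrite -fE scale0r addr0.
have qE : (fun h : R => h^-1 * ((p i).[h] - (p i).[0])) =
    (fun h : R => (h^-1 *: (f (x + h *: v) - f x)) i).
  by apply: funext => h; rewrite -f0 -fE.
by have := @horner_difference_quotient R (p i); rewrite qE.
Qed.

(** * The full and the empty ordered subtree *)

Section OrderedSubtrees.
Variable t : rtree.
Implicit Type s : {set 'I_(Defs.tsize t)}.

Lemma forest_setT : forest [set: 'I_(Defs.tsize t)]%SET = [::].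
Proof.
rewrite /forest (_ : forest_roots _ = finset.set0) ?enum_set0 //.
by apply/setP => v; rewrite !inE.
Qed.

(** By [forest_rootP], a vertex outside [s] would lie in the component of some forest root. *)
Lemma forest_nil s : s \in OST t -> forest s = [::] -> s = [set: _]%SET.
Proof.
move=> sO fs; apply/setP => v; rewrite inE; apply/negPn/negP => vs.
have [r [[rf _] _]] := forest_rootP sO vs.
have : r \in enum (forest_roots s) by rewrite mem_enum.
by move: fs; rewrite /forest; case: (enum _).
Qed.

Lemma setT_connected :
  (troot t \in [set: 'I_(Defs.tsize t)]%SET) && connected_in [set: 'I_(Defs.tsize t)]%SET.
Proof.
rewrite inE; apply/connected_inP => x y _ _.
have [_ _ tconn _] := rtree_is_tree t.
apply: connect_sub (tconn x y) => u w uw; apply: connect1.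
by rewrite /edge_in /= !inE.
Qed.

Lemma setT_in_OST : [set: 'I_(Defs.tsize t)]%SET \in OST t.
Proof. by rewrite inE setT_connected implybT. Qed.

(** The induced tree has vertices ['I_#|s|], so it is only isomorphic to [t], through [enum_val];
    equality holds in the quotient. *)
Lemma tree_of_induced_setT s (h : (troot t \in s) && connected_in s) :
  s = [set: _]%SET -> Defs.tree_of (Defs.induced h) = Defs.tree_of t.
Proof.
move=> sT; apply/eqmodP/asboolP.
exists (@enum_val _ (mem s)); split => //=.
- exists (enum_rank_in (andP h).1); first exact: enum_valK_in.
  by move=> x; rewrite enum_rankK_in // sT inE.
- by rewrite enum_rankK_in // sT inE.
Qed.

Lemma subtree_setT : subtree [set: 'I_(Defs.tsize t)]%SET = Some (Defs.tree_of t).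
Proof.
rewrite /subtree; case: {-}_ / idP => [h|]; last by rewrite setT_connected.
by congr Some; exact: tree_of_induced_setT.
Qed.

Lemma subtree_set0 : subtree (@finset.set0 'I_(Defs.tsize t)) = None.
Proof. by rewrite /subtree; case: {-}_ / idP => // h; exfalso; move: h; rewrite inE. Qed.

End OrderedSubtrees.

(** * Left translations, left invariant fields and their derivatives *)

Section ButcherDerivatives.
Variable R : realType.
Local Notation RT := (ptfun R tree).

Lemma butcher_chart_inv_Some (x : RT) (tau : tree) :
  butcher_chart_inv x (Some tau) = x tau.
Proof. by rewrite /= add0r. Qed.

Lemma butcher_chart_one : butcher_chart (butcher_one R) = 0.
Proof. by apply: funext => tau; rewrite /butcher_chart subrr. Qed.

(** The product is affine in its second factor, so the derivative does not depend on [x]. *)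
Lemma butcher_left_translation_derive (g : butcher R) (x v : RT) :
  is_dir_derive (butcher_left_translation g) x v
    (fun tau => \sum_(s in OST (repr tau)%qT)
                  ext0 v (subtree s) * forest_eval g (forest s)).
Proof.
pose p (tau : tree) : {poly R} := \sum_(s in OST (repr tau)%qT)
  (butcher_chart_inv x (subtree s) * forest_eval g (forest s))%:P +
  \sum_(s in OST (repr tau)%qT)
  (ext0 v (subtree s) * forest_eval g (forest s))%:P * 'X.
have -> : (fun tau => \sum_(s in OST (repr tau)%qT)
    ext0 v (subtree s) * forest_eval g (forest s)) = (fun tau => (p tau)`_1).
  apply: funext => tau; rewrite coefD !coef_sum [X in _ = X + _]big1 ?add0r.
    by apply: eq_bigr => s _; rewrite coefMX coefC.
  by move=> s _; rewrite coefC.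
apply: is_dir_derive_horner => h tau.
rewrite hornerD !horner_sum -big_split /=.
rewrite /butcher_left_translation /left_translation /butcher_chart /= subr0.
apply: eq_bigr => s _; rewrite hornerMX !hornerC /=.
(* On the empty tree the second factor is constantly 1, matching the value 0 of [ext0 v]. *)
case: (subtree s) => [theta|] /=; last by rewrite !mul0r !addr0.
by rewrite mulrAC -mulrDl -addrA [v theta * h]mulrC.
Qed.

Lemma butcher_left_invariant_fieldE (a x : RT) (tau : tree) :
  butcher_left_invariant_field a x tau =
  \sum_(s in OST (repr tau)%qT)
    ext0 a (subtree s) * \prod_(theta <- forest s) x theta.
Proof.
rewrite /butcher_left_invariant_field /left_invariant_field.
rewrite (dir_derive_unique _ _ _ _ _ _ (butcher_left_translation_derive _ _ _)).
apply: eq_bigr => s _; congr (_ * _); apply: eq_bigr => theta _.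
exact: butcher_chart_inv_Some.
Qed.

Lemma butcher_left_invariant_field0 (a : RT) :
  butcher_left_invariant_field a 0 = a.
Proof.
apply: funext => tau; rewrite butcher_left_invariant_fieldE.
rewrite (bigD1 _ (setT_in_OST _)) /= [X in _ + X]big1 ?addr0.
  by rewrite forest_setT big_nil mulr1 subtree_setT /= /Defs.tree_of reprK.
move=> s /andP[sO sT]; case fs: (forest s) => [|theta F].
  by rewrite (forest_nil _ _ sO fs) eqxx in sT.
by rewrite big_cons mul0r mulr0.
Qed.

(** Coordinate [tau] of the field of [a] at [x + h v], with the indeterminate in place of [h]. *)
Definition field_line_poly (a x v : RT) (tau : tree) : {poly R} :=
  \sum_(s in OST (repr tau)%qT) (ext0 a (subtree s))%:P *
    \prod_(theta <- forest s) ((x theta)%:P + (v theta)%:P * 'X).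

Lemma butcher_left_invariant_field_derive (a x v : RT) :
  is_dir_derive (butcher_left_invariant_field a) x v
    (fun tau => (field_line_poly a x v tau)`_1).
Proof.
apply: is_dir_derive_horner => h tau.
rewrite butcher_left_invariant_fieldE horner_sum; apply: eq_bigr => s _.
rewrite hornerCM horner_prod; congr (_ * _); apply: eq_bigr => theta _.
by rewrite hornerD hornerMX !hornerC [v theta * h]mulrC.
Qed.

Lemma butcher_left_invariant_field_derive0 (a v : RT) (tau : tree) :
  dir_derive (butcher_left_invariant_field a) 0 v tau =
  \sum_(s in SP1 (repr tau)%qT) ext0 a (subtree s) * ext0 v (remainder s).
Proof.
rewrite (dir_derive_unique _ _ _ _ _ _ (butcher_left_invariant_field_derive _ _ _)).
rewrite /field_line_poly coef_sum.
(* Both sums are put over all ordered subtrees, to be compared term by term. *)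
rewrite [RHS](eq_bigl (fun s => (s \in OST (repr tau)%qT) && (s \in SP1 (repr tau)%qT))); last first.
  by move=> s /=; rewrite andb_idl // inE => /andP[].
rewrite [RHS]big_mkcondr /=; apply: eq_bigr => s sO; rewrite coefCM.
have -> : \prod_(theta <- forest s) (((0 : RT) theta)%:P + (v theta)%:P * 'X)
    = \prod_(theta <- forest s) ((v theta)%:P * 'X) :> {poly R}.
  by apply: eq_bigr => theta _; rewrite add0r.
rewrite coef1_prod_monomials inE sO /remainder /=.
(* The empty subtree also leaves a single tree; its term vanishes because [ext0 a] is 0 at the empty
   tree. *)
have [->|s0] := eqVneq s finset.set0; first by rewrite subtree_set0 mul0r.
have [->|sT] := eqVneq s [set: _]%SET; first by rewrite forest_setT mulr0.
by case: (forest s) => [|theta [|theta' F]] //=; rewrite mulr0.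
Qed.

End ButcherDerivatives.

Theorem theoremB (R : realType) :
  [/\ forall (g : butcher R) (x v : ptfun R tree),
        dir_derivable (butcher_left_translation g) x v,
      forall a x v : ptfun R tree,
        dir_derivable (butcher_left_invariant_field a) x v
    & forall (a b : ptfun R tree) (tau : tree),
        butcher_lie_bracket a b tau =
        let t := (repr tau)%qT in
        \sum_(s in SP1 t)
          (ext0 b (subtree s) * ext0 a (remainder s)
           - ext0 b (remainder s) * ext0 a (subtree s))].
Proof.
split.
- by move=> g x v; eexists; exact: butcher_left_translation_derive.
- by move=> a x v; eexists; exact: butcher_left_invariant_field_derive.
move=> a b tau.
rewrite /butcher_lie_bracket /lie_bracket /vf_bracket butcher_chart_one.
rewrite -/(butcher_left_invariant_field a) -/(butcher_left_invariant_field b).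
rewrite !butcher_left_invariant_field0.
(* Subtraction of functions is evaluated at [tau] by conversion. *)
transitivity (dir_derive (butcher_left_invariant_field b) 0 a tau
  - dir_derive (butcher_left_invariant_field a) 0 b tau) => //.
rewrite !butcher_left_invariant_field_derive0 -sumrB.
by apply: eq_bigr => s _; rewrite [ext0 a (subtree s) * _]mulrC.
Qed.
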